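(* Let $H$ be any complex Hilbert space, finite- or infinite-dimensional. For any invertible $A,B\in B(H)$, $$\operatorname{OLC}(AB)\le\operatorname{OLC}(A)+\operatorname{OLC}(B).$$ Equivalently, $$\operatorname{OMC}(AB)\le\frac{\operatorname{OMC}(A)+\operatorname{OMC}(B)}{1+\operatorname{OMC}(A)\operatorname{OMC}(B)}.$$
   Context: $B(H)$ is the algebra of bounded operators on $H$ with operator norm $\|\cdot\|$. For invertible $A\in B(H)$: $\kappa(A):=\|A\|\,\|A^{-1}\|$, $\operatorname{OMC}(A):=\dfrac{\kappa(A)-1}{\kappa(A)+1}$, and $\operatorname{OLC}(A):=\operatorname{arctanh}(\operatorname{OMC}(A))=\tfrac12\ln\kappa(A)$. *)

(* Defs.v *)
From HB Require Import structures.
From mathcomp Require Import all_boot all_order all_algebra.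
From mathcomp Require Import all_classical all_reals all_analysis.
From mathcomp Require Import sesquilinear complex ring lra.
Set Implicit Arguments.
Unset Strict Implicit.
Unset Printing Implicit Defensive.
Import Order.TTheory GRing.Theory Num.Theory.
Import numFieldNormedType.Exports.
Local Open Scope classical_set_scope.
Local Open Scope complex_scope.
Local Open Scope ring_scope.

(* Complex Hilbert spaces: complete normed modules over R[i] whose norm comes
   from an inner product.  The inner product is linear in its first argument.
   Norms in a module over R[i] are R[i]-valued (they are nonnegative, hence
   real). *)
HB.mixin Record NormedModule_hasInner (R : realType) H
    & NormedModule R[i] H := {
  inner : {dot H for (@Num.conj R[i])};
  inner_normE : forall x : H, `|x| ^+ 2 = inner x x
}.

#[short(type="hilbertType")]
HB.structure Definition Hilbert (R : realType) :=
  {H of CompleteNormedModule R[i] H & NormedModule_hasInner R H}.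

HB.mixin Record isBoundedOp (R : realType) (H : hilbertType R) (A : H -> H) := {
  bounded_op_subproof : exists M : R, forall x : H, `|A x| <= M%:C * `|x|
}.

#[short(type="boundedOp")]
HB.structure Definition BoundedOp (R : realType) (H : hilbertType R) :=
  {A of @GRing.Linear R[i] H H ( *:%R ) A & isBoundedOp R H A}.

Notation "''B' ( H )" := (boundedOp H) (format "''B' ( H )").

Section BoundedOp.
Variables (R : realType) (H : hilbertType R).
Implicit Types A B : 'B(H).

Lemma boundedOp_eqP A B : A = B <-> A =1 B.
Proof.
split=> [-> //|/funext].
case: A B => f [[fD] [fZ] [fB]] [g [[gD] [gZ] [gB]]] /= efg; subst g.
by rewrite (Prop_irrelevance fD gD) (Prop_irrelevance fZ gZ)
  (Prop_irrelevance fB gB).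
Qed.

Let id_bounded : exists M : R, forall x : H, `|(idfun x : H)| <= M%:C * `|x|.
Proof. by exists 1 => x; rewrite mul1r. Qed.

HB.instance Definition _ := isBoundedOp.Build R H idfun id_bounded.

Let comp_bounded A B : exists M : R, forall x : H, `|(A \o B) x| <= M%:C * `|x|.
Proof.
have [M hM] := @bounded_op_subproof _ _ A.
have [N hN] := @bounded_op_subproof _ _ B.
exists (`|M| * N) => x /=; rewrite rmorphM/= -mulrA.
apply: (le_trans (hM _)); apply: (@le_trans _ _ (`|M|%:C * `|B x|)).
  by rewrite ler_wpM2r// lecR ler_norm.
by rewrite ler_wpM2l// ?lecR// hN.
Qed.

HB.instance Definition _ A B := isBoundedOp.Build R H (A \o B) (comp_bounded A B).

Definition op_id : 'B(H) := idfun.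
Definition op_mul A B : 'B(H) := A \o B.

Definition opnorm A : R :=
  sup [set complex.Re `|A x| | x in [set x : H | `|x| <= 1]].

Definition op_invertible A :=
  exists A', op_mul A A' = op_id /\ op_mul A' A = op_id.

(* Total version of the inverse: A itself when A is not invertible. *)
Definition op_inv A : 'B(H) :=
  if pselect (op_invertible A) is left e then projT1 (cid e) else A.

Definition kappa A : R := opnorm A * opnorm (op_inv A).

Definition OMC A : R := (kappa A - 1) / (kappa A + 1).

End BoundedOp.

Definition arctanh (R : realType) (x : R) : R := 2^-1 * ln ((1 + x) / (1 - x)).

(* On the zero space kappa is 0 and OMC is -1, so OLC takes the junk value
   1/2 * ln 0 = 0; otherwise kappa A >= 1 for every invertible A. *)
Definition OLC (R : realType) (H : hilbertType R) (A : 'B(H)) : R :=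
  arctanh (OMC A).

Lemma tanhK (R : realType) (y : R) :
  arctanh ((expR y - expR (- y)) / (expR y + expR (- y))) = y.
Proof.
have e1 : 0 < expR y := expR_gt0 y.
have e2 : 0 < expR (- y) := expR_gt0 (- y).
rewrite /arctanh (_ : _ / _ = expR (y *+ 2)).
  by rewrite expRK; field.
rewrite mulr2n expRD -[X in _ = _ * X]invrK -expRN; field.
by apply/and3P; split; rewrite lt0r_neq0//; lra.
Qed.

Lemma opnorm_ge0 (R : realType) (H : hilbertType R) (A : 'B(H)) : 0 <= opnorm A.
Proof.
have [M hM] := @bounded_op_subproof _ _ A.
apply: ub_le_sup; last first.
  by exists 0; rewrite /= ?linear0 ?normr0.
exists `|M| => _ [x /= x1 <-].
suff : `|A x| <= `|M|%:C by rewrite lecE/= => /andP[].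
apply: (le_trans (hM x)); apply: (@le_trans _ _ (`|M|%:C * `|x|)).
  by rewrite ler_wpM2r// lecR ler_norm.
by rewrite ler_piMr// lecR.
Qed.

Lemma OLCE (R : realType) (H : hilbertType R) (A : 'B(H)) :
  OLC A = 2^-1 * ln (kappa A).
Proof.
have k0 : 0 <= kappa A by rewrite mulr_ge0 ?opnorm_ge0.
rewrite /OLC /arctanh /OMC; congr (_ * ln _); field.
by apply/andP; split; rewrite lt0r_neq0//; lra.
Qed.

(* Main.v *)
(* Composition is submultiplicative for the operator norm and (AB)^-1 is
   B^-1 A^-1, so kappa (AB) <= kappa A * kappa B.  Both inequalities follow,
   since OLC is half the logarithm of kappa, and since the right-hand side of
   the second one is (kappa A * kappa B - 1) / (kappa A * kappa B + 1). *)
Require Import Defs.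
From mathcomp Require Import all_boot all_order all_algebra.
From mathcomp Require Import all_classical all_reals all_analysis.
From mathcomp Require Import complex ring lra.
Import Order.TTheory GRing.Theory Num.Theory.
Local Open Scope ring_scope.

Section OperatorNorm.
Local Set Implicit Arguments.
Local Unset Strict Implicit.
Context {R : realType} {H : hilbertType R}.
Implicit Types (A B : 'B(H)) (x : H).
Local Open Scope complex_scope.
Local Open Scope classical_set_scope.

(** Norms on [H] take values in [R[i]] while [opnorm] is real; this identity passes between the
    two. *)
Let normE x : `|x| = (complex.Re `|x|)%:C.
Proof. by rewrite RRe_real// normr_real. Qed.

Lemma opnorm_ub A x : `|x| <= 1 -> complex.Re `|A x| <= opnorm A.
Proof.
move=> x1; apply: ub_le_sup; last by exists x.
have [M hM] := @bounded_op_subproof _ _ A.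
(* The bound [M] may be negative, hence its absolute value. *)
exists `|M| => _ [y /= y1 <-].
suff : `|A y| <= `|M|%:C by rewrite lecE/= => /andP[].
apply: (le_trans (hM y)); apply: (@le_trans _ _ (`|M|%:C * `|y|)).
  by rewrite ler_wpM2r// lecR ler_norm.
by rewrite ler_piMr// lecR.
Qed.

(** For [x] nonzero, rescale to a unit vector and use homogeneity. *)
Lemma opnormP A x : `|A x| <= (opnorm A)%:C * `|x|.
Proof.
have [->|x0] := eqVneq x 0; first by rewrite linear0 !normr0 mulr0.
have nx0 : 0 < `|x| by rewrite normr_gt0.
rewrite -ler_pdivrMr// mulrC.
have -> : `|x|^-1 * `|A x| = `|A (`|x|^-1 *: x)|.
  by rewrite linearZ normrZ normfV normr_id.
rewrite normE lecR; apply: opnorm_ub.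
by rewrite normrZ normfV normr_id mulVf// gt_eqF.
Qed.

Lemma opnorm_le A (c : R) :
  (forall x, `|x| <= 1 -> `|A x| <= c%:C) -> opnorm A <= c.
Proof.
move=> Ac; apply: ge_sup.
  by exists (complex.Re `|A 0|), 0 => //=; rewrite normr0.
by move=> _ [x /= x1 <-]; rewrite -lecR -normE Ac.
Qed.

Lemma opnorm_mul A B : opnorm (op_mul A B) <= opnorm A * opnorm B.
Proof.
apply: opnorm_le => x x1; apply: (le_trans (opnormP A (B x))).
rewrite rmorphM/= ler_wpM2l ?lecR ?opnorm_ge0//.
by apply: (le_trans (opnormP B x)); rewrite ler_piMr// lecR opnorm_ge0.
Qed.

Lemma op_invP A : op_invertible A ->
  op_mul A (op_inv A) = @op_id _ H /\ op_mul (op_inv A) A = @op_id _ H.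
Proof.
move=> hA; rewrite /op_inv; case: pselect => // e.
exact: (projT2 (cid e)).
Qed.

Lemma op_invK A : op_invertible A -> cancel A (op_inv A).
Proof. by move=> /op_invP[_ /boundedOp_eqP h] x; exact: h. Qed.

Lemma op_invKV A : op_invertible A -> cancel (op_inv A) A.
Proof. by move=> /op_invP[/boundedOp_eqP h _] x; exact: h. Qed.

Lemma op_invertible_mul A B :
  op_invertible A -> op_invertible B -> op_invertible (op_mul A B).
Proof.
move=> hA hB; exists (op_mul (op_inv B) (op_inv A)).
split; apply/boundedOp_eqP => x /=.
  by rewrite op_invKV// op_invKV.
by rewrite op_invK// op_invK.
Qed.

(** [AB] is injective, and it sends both candidates applied to [x] back to [x]. *)
Lemma op_inv_mul A B : op_invertible A -> op_invertible B ->
  op_inv (op_mul A B) = op_mul (op_inv B) (op_inv A).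
Proof.
move=> hA hB; apply/boundedOp_eqP => x.
have hAB := op_invertible_mul hA hB.
apply: (can_inj (op_invK hAB)); rewrite op_invKV//=.
by rewrite op_invKV// op_invKV.
Qed.

Lemma kappa_ge0 A : 0 <= kappa A.
Proof. by rewrite mulr_ge0 ?opnorm_ge0. Qed.

Lemma kappa_mul A B : op_invertible A -> op_invertible B ->
  kappa (op_mul A B) <= kappa A * kappa B.
Proof.
move=> hA hB; rewrite /kappa op_inv_mul//.
(* The factors are regrouped as ([A], [B]) and (inverse of [B], inverse of [A]), so that
   submultiplicativity applies to each pair. *)
rewrite mulrACA [X in _ <= _ * X]mulrC.
by apply: ler_pM; rewrite ?opnorm_ge0 ?opnorm_mul.
Qed.

(* The first case is that of the zero space. *)
Lemma kappa_eq0_or_ge1 A : op_invertible A -> kappa A = 0 \/ 1 <= kappa A.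
Proof.
move=> hA; have [[x x0]|H0] := pselect (exists x : H, x != 0).
  right; have nx0 : 0 < `|x| by rewrite normr_gt0.
  (* Multiply by the norm of [x], write [x] as [A (op_inv A x)] and bound by the operator norms
     twice. *)
  rewrite -lecR -(ler_pM2r nx0) mul1r rmorphM/= -mulrA.
  rewrite -{1}(op_invKV hA x); apply: (le_trans (opnormP A _)).
  by rewrite ler_wpM2l ?lecR ?opnorm_ge0// opnormP.
left; suff A0 : opnorm A = 0 by rewrite /kappa A0 mul0r.
apply/eqP; rewrite eq_le opnorm_ge0 andbT.
apply: opnorm_le => x _; have -> : x = 0.
  by apply/eqP; apply: contrapT => x0; apply: H0; exists x; exact/negP.
by rewrite linear0 normr0.
Qed.

Lemma OLC_mul A B : op_invertible A -> op_invertible B ->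
  OLC (op_mul A B) <= OLC A + OLC B.
Proof.
move=> hA hB; rewrite !OLCE -mulrDr ler_pM2l ?invr_gt0//.
have kAB := kappa_mul hA hB.
have ln_ge0_kappa (C : 'B(H)) : op_invertible C -> 0 <= ln (kappa C).
  by case/kappa_eq0_or_ge1=> [->|/ln_ge0//]; rewrite ln0.
(* If [kappa] of the product is 0, the left side is the default value [ln 0 = 0] and the right side
   is nonnegative. *)
have [k0|k1] := kappa_eq0_or_ge1 (op_invertible_mul hA hB).
  by rewrite k0 ln0// addr_ge0 ?ln_ge0_kappa.
(* Otherwise both factors are positive, so [ln] turns their product into a sum and is monotone. *)
have kAkB : 0 < kappa A * kappa B by apply: lt_le_trans kAB; lra.
have kA0 : 0 < kappa A.
  by rewrite lt0r kappa_ge0 andbT; apply: contraTneq kAkB => ->; rewrite mul0r ltxx.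
have kB0 : 0 < kappa B by rewrite pmulr_rgt0 in kAkB.
by rewrite -lnM ?posrE// ler_ln ?posrE//; lra.
Qed.

Lemma OMC_mul A B : op_invertible A -> op_invertible B ->
  OMC (op_mul A B) <= (OMC A + OMC B) / (1 + OMC A * OMC B).
Proof.
move=> hA hB; have kAB := kappa_mul hA hB.
have [a0 b0] := (kappa_ge0 A, kappa_ge0 B).
have c0 := kappa_ge0 (op_mul A B).
rewrite /OMC; move: (kappa (op_mul A B)) (kappa A) (kappa B) a0 b0 c0 kAB =>
  c a b a0 b0 c0 cab.
have ab0 : 0 <= a * b by rewrite mulr_ge0.
(* Over the common denominator [(a + 1) * (b + 1)], the numerator becomes [2 * (a * b - 1)] and the
   denominator [2 * (a * b + 1)], which is positive. *)
have -> : ((a - 1) / (a + 1) + (b - 1) / (b + 1)) /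
    (1 + (a - 1) / (a + 1) * ((b - 1) / (b + 1))) = (a * b - 1) / (a * b + 1).
  by field; do ?[apply/andP; split]; rewrite lt0r_neq0//; nra.
(* Cross-multiplying, the terms in [a * b * c] cancel and [c <= a * b] remains. *)
rewrite ler_pdivrMr; last lra.
rewrite mulrAC ler_pdivlMr; last lra.
by nra.
Qed.

End OperatorNorm.

Theorem theorem4p1 (R : realType) (H : hilbertType R) (A B : 'B(H))
    (hA : op_invertible A) (hB : op_invertible B) :
  OLC (op_mul A B) <= OLC A + OLC B /\
  (OLC (op_mul A B) <= OLC A + OLC B <->
   OMC (op_mul A B) <= (OMC A + OMC B) / (1 + OMC A * OMC B)).
Proof.
have h1 := OLC_mul hA hB; have h2 := OMC_mul hA hB.
(* Both inequalities hold outright, so each implies the other. *)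
by split=> //; split.
Qed.
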